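(* Let $\mathcal{X}$ be a compact Polish space, $\mathcal{L}:\mathcal{X}\to[-\infty,\infty)$ upper semicontinuous, $P\in\mathcal{P}(\mathcal{X})$, $D$ a pre-divergence such that $Q\mapsto D(Q\|P)$ is lower semicontinuous and $D(\mu_n\|P)\to0$ implies $\mu_n\to P$ weakly, and $c$ a cost function. For $r>0$ let $c_r=rc$. Then for every $\epsilon>0$, \[\lim_{r\to0^+}\sup_{Q:D^{c_r}(Q\|P)\leq r\epsilon}E_Q[\mathcal{L}]=\sup_{Q:C(P,Q)\leq\epsilon}E_Q[\mathcal{L}].\] Moreover, if $\{\mathcal{L}_\theta\}_{\theta\in\Theta}$ is a family of upper semicontinuous functions $\mathcal{X}\to[-\infty,\infty)$, then \[\lim_{r\to0^+}\inf_{\theta\in\Theta}\sup_{Q:D^{c_r}(Q\|P)\leq r\epsilon}E_Q[\mathcal{L}_\theta]=\inf_{\theta\in\Theta}\sup_{Q:C(P,Q)\leq\epsilon}E_Q[\mathcal{L}_\theta].\]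
   Context: $\mathcal{P}(\mathcal{X})$ is the set of Borel probability measures on $\mathcal{X}$ with the weak topology; suprema are over $Q\in\mathcal{P}(\mathcal{X})$. A pre-divergence is $D:\mathcal{P}(\mathcal{X})\times\mathcal{P}(\mathcal{X})\to[0,\infty]$ with $D(\mu\|\mu)=0$ for all $\mu$. A cost function is a lower semicontinuous $c:\mathcal{X}\times\mathcal{X}\to[0,\infty]$, with OT cost $C(\mu,\nu)=\inf\{\int c\,d\pi:\pi\in\mathcal{P}(\mathcal{X}\times\mathcal{X}),\pi_1=\mu,\pi_2=\nu\}$. For a cost function $c'$ with OT cost $C'$, $D^{c'}(\nu\|\mu)=\inf_{\eta\in\mathcal{P}(\mathcal{X})}\{D(\eta\|\mu)+C'(\eta,\nu)\}$. *)

(* Defs.v *)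
From HB Require Import structures.
From mathcomp Require Import all_boot all_order all_algebra.
From mathcomp Require Import all_classical all_reals all_analysis.
Set Implicit Arguments. Unset Strict Implicit. Unset Printing Implicit Defensive.
Import Order.TTheory GRing.Theory Num.Theory numFieldNormedType.Exports.
Local Open Scope classical_set_scope.
Local Open Scope ring_scope.

Section Defs.
Context {R : realType} {X : pseudoPMetricType R}.

Definition borel := g_sigma_algebraType (@open X).

Definition prob := probability borel R.

Local Open Scope ereal_scope.

Definition upper_semicontinuous (f : X -> \bar R) := forall (x : X) (a : R),
  f x < a%:E -> exists2 V, nbhs x V & forall y, V y -> f y < a%:E.

Definition bcont (f : X -> R) :=
  continuous f /\ exists M : R, forall x, (`|f x| <= M)%R.

Definition weak_cvg (mu : nat -> prob) (nu : prob) := forall f : X -> R,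
  bcont f ->
  (\int[mu n]_x (f x)%:E) @[n --> \oo] --> \int[nu]_x (f x)%:E.

(* lower semicontinuity of F : P(X) -> [0,oo] for the weak topology, i.e. the
   coarsest topology making Q |-> int f dQ continuous for all bounded continuous
   f (neighbourhood base: finitely many such f and a radius e > 0). *)
Definition weak_lsc (F : prob -> \bar R) := forall (Q : prob) (a : R),
  a%:E < F Q ->
  exists (n : nat) (f : 'I_n -> X -> R) (e : R),
    [/\ (0 < e)%R, (forall i, bcont (f i)) &
      forall Q' : prob,
        (forall i, `| \int[Q']_x (f i x)%:E - \int[Q]_x (f i x)%:E | < e%:E) ->
        a%:E < F Q'].

Definition coupling (mu nu : prob) (pi : probability (borel * borel)%type R) :=
  (forall A : set borel, measurable A -> pi (A `*` setT) = mu A) /\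
  (forall B : set borel, measurable B -> pi (setT `*` B) = nu B).

Definition OTcost (c : X -> X -> \bar R) (mu nu : prob) : \bar R :=
  ereal_inf [set \int[pi]_z c z.1 z.2 |
             pi in [set pi : probability (borel * borel)%type R | coupling mu nu pi]].

Definition Dc (D : prob -> prob -> \bar R) (c' : X -> X -> \bar R) (nu mu : prob)
  : \bar R :=
  ereal_inf [set D eta mu + OTcost c' eta nu | eta in [set: prob]].

Definition expect (Q : prob) (L : X -> \bar R) : \bar R := \int[Q]_x L x.

Definition robust_sup (D : prob -> prob -> \bar R) (c : X -> X -> \bar R)
  (P : prob) (eps r : R) (L : X -> \bar R) : \bar R :=
  ereal_sup [set expect Q L |
             Q in [set Q : prob | Dc D (fun x y => r%:E * c x y) Q P <= (r * eps)%:E]].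

Definition ot_sup (c : X -> X -> \bar R) (P : prob) (eps : R) (L : X -> \bar R)
  : \bar R :=
  ereal_sup [set expect Q L | Q in [set Q : prob | OTcost c P Q <= eps%:E]].

End Defs.

(* Main.v *)
Require Import Defs.
From HB Require Import structures.
From mathcomp Require Import all_boot all_order all_algebra.
From mathcomp Require Import all_classical all_reals all_analysis.
From mathcomp Require Import lra measurable_realfun.
Import Order.TTheory GRing.Theory Num.Theory numFieldNormedType.Exports.
Local Open Scope classical_set_scope.
Local Open Scope ring_scope.

(** Since eta = P is admissible in D^{c_r}, the left-hand side dominates the
    right-hand side for every r > 0. Conversely, if the inequality failed in the
    limit there would be r_n -> 0, measures eta_n with D(eta_n || P) -> 0, hence
    eta_n -> P weakly, and couplings pi_n of (eta_n, Q_n) with cost at most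
    eps + o(1) and E_{Q_n}[L] > B. A limit pi of the pi_n has first marginal P,
    cost at most eps, and its second marginal Q satisfies E_Q[L] >= B, because
    integrals of nonnegative lower semicontinuous functions do not increase in
    the limit.

    The limit is built without Riesz representation. Take a countable base C_i
    of the space; the cells are the sets of points with a prescribed membership
    in C_0, ..., C_(m-1). The limits of the masses of the cells along an
    ultrafilter are consistent, so nested subintervals of [0, 1) of these lengths
    attach to each w in [0, 1) a decreasing sequence of nonempty cells; by
    compactness and regularity these converge to a point f w, and the limit
    measure is the law of f under Lebesgue measure. Integrals of a lower
    semicontinuous h are bounded through the infima of h over the cells, which
    take finitely many values at each level and whose limit dominates h (f w). *)

(** * Realizing a random bit sequence on the unit interval *)

Section bits_realization.
Context {R : realType} (a : seq bool -> R).

(* Bit lists have their most recent bit first; [bits_lo s] is the left endpoint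
   of the interval of length [a s] attached to [s]. *)
Fixpoint bits_lo (s : seq bool) : R :=
  if s is b :: s' then bits_lo s' + (if b then a (false :: s') else 0) else 0.

(** The address of [w] in the nested subdivision: the [false] child is the left part of its parent
    interval, so a bit is [true] from the splitting point on. *)
Fixpoint bits_code (m : nat) (w : R) : seq bool :=
  if m is m'.+1 then
    let s := bits_code m' w in (bits_lo s + a (false :: s) <= w) :: s
  else [::].

Hypotheses (a_ge0 : forall s, 0 <= a s) (a_nil : a [::] = 1)
  (a_split : forall s, a s = a (false :: s) + a (true :: s)).

Lemma bits_codeE (s : seq bool) (w : R) : 0 <= w < 1 ->
  (bits_code (size s) w == s) = (bits_lo s <= w < bits_lo s + a s).
Proof.
move=> w01; elim: s => [|b s IH]; first by rewrite /= eqxx a_nil add0r w01.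
rewrite /= eqseq_cons.
have := a_split s; have := a_ge0 (true :: s); have := a_ge0 (false :: s).
have [e|ne] := eqVneq (bits_code (size s) w) s.
  move: IH; rewrite e eqxx andbT => /esym/andP[h1 h2] p1 p2 es.
  case: b => /=; rewrite ?(eqb_id, eqbF_neg) -?ltNge ?addr0.
    by apply/idP/andP; lra.
  by apply/idP/andP; lra.
(* If the older bits already differ, [w] is outside the parent interval, hence outside both
   children. *)
move: IH; rewrite (negbTE ne) andbF => /esym/negbT/negP nin p1 p2 es.
apply/esym/negP => /andP[h1 h2]; apply: nin; apply/andP.
by case: b h1 h2 => h1 h2; split; lra.
Qed.

Lemma bits_lo_bounds (s : seq bool) : 0 <= bits_lo s /\ bits_lo s + a s <= 1.
Proof.
elim: s => [|b s [h1 h2]] /=; first by rewrite a_nil; lra.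
have := a_split s; have := a_ge0 (true :: s); have := a_ge0 (false :: s).
by case: b => /=; lra.
Qed.

Lemma size_bits_code m w : size (bits_code m w) = m.
Proof. by elim: m => //= m ->. Qed.

Lemma bits_realization :
  exists (P : probability (measurableTypeR R) R) (code : nat -> R -> seq bool),
  [/\ forall w, code 0 w = [::],
      forall m w, exists b, code m.+1 w = b :: code m w,
      forall m w, 0 < a (code m w) &
      forall s, measurable [set w : measurableTypeR R | code (size s) w = s] /\
        P [set w | code (size s) w = s] = (a s)%:E].
Proof.
have m01 : measurable (`[0%R, 1%R[%classic : set (measurableTypeR R)) by [].
pose P0 := mrestr (@lebesgue_measure R) m01.
have P0T : P0 setT = 1%E.
  rewrite /P0 /mrestr setTI /= lebesgue_measure_itv/= lte01 -EFinB subr0//.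
pose P : probability (measurableTypeR R) R :=
  HB.pack P0 (Measure_isProbability.Build _ _ _ P0 P0T).
(* Codes must exist for every real [w]; points outside [0, 1), which are null for [P], borrow the
   code of 0. A half-open interval containing [u w] has positive length, hence [0 < a] at every
   code. *)
pose u (w : R) : R := if (0 <= w < 1) then w else 0.
have u01 w : 0 <= u w < 1 by rewrite /u; case: ifP; rewrite ?lexx ?ltr01.
exists P, (fun m w => bits_code m (u w)); split => //.
- by move=> m w; eexists.
- move=> m w; have := bits_codeE (bits_code m (u w)) (u w) (u01 w).
  by rewrite size_bits_code eqxx => /esym/andP[]; lra.
- move=> s.
  have mu : measurable_fun setT (u : measurableTypeR R -> measurableTypeR R).
    apply: measurable_fun_ifT => //.
    by apply: measurable_and; [exact: measurable_fun_ler|exact: measurable_fun_ltr].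
  have e : [set w | bits_code (size s) (u w) = s] =
      u @^-1` `[bits_lo s, bits_lo s + a s[%classic.
    apply/seteqP; split => w /=; rewrite in_itv/=.
      by move=> /eqP; rewrite bits_codeE.
    by rewrite -bits_codeE// => /eqP.
  split; first by rewrite e -(setTI (_ @^-1` _)); exact: mu.
  rewrite e /= /P0 /mrestr/= (_ : _ `&` _ = `[bits_lo s, bits_lo s + a s[%classic).
    rewrite lebesgue_measure_itv/= lte_fin; case: ifPn => h.
      by rewrite -EFinD addrC addKr.
    by congr EFin; have := a_ge0 s; lra.
  have [h1 h2] := bits_lo_bounds s.
  apply/seteqP; split => w /=; rewrite /u !in_itv/=.
    by move=> [+ h]; rewrite h.
  move=> h; suff -> : 0 <= w < 1 by [].
  by move/andP: h => [h3 h4]; apply/andP; lra.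
Qed.
End bits_realization.

(** * Ultrafilter limits, functions of finite range and countable bases *)

Lemma ultra_cvg_itv {R : realType} {I : Type} (U : set_system I) (FU : UltraFilter U)
  (x : I -> R) (a b : R) : (forall i, a <= x i <= b) -> exists l : R, x @ U --> l.
Proof.
move=> xab; have [|l [_ xl]] := @segment_compact R a b (x @ U) _.
  by apply: (@filterE _ U) => i; rewrite /= in_itv/= xab.
(* The ultrafilter contains the preimage of [V] or of its complement; the cluster point [l] rules
   out the latter. *)
exists l => V Vl; have [//|nV] := in_ultra_setVsetC (x @^-1` V) FU.
by have [y []] := xl (~` V) V nV Vl.
Qed.

Lemma integral_finite_range {R : realType} {d} {T : measurableType d}
    (mu : {measure set T -> \bar R}) (I : finType) (k : T -> I) (F : I -> R) :
  (forall i, measurable [set x | k x = i]) -> (forall i, 0 <= F i) ->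
  (\int[mu]_x (F (k x))%:E = \sum_i (F i)%:E * mu [set x | k x = i])%E.
Proof.
move=> mk F0.
transitivity (\int[mu]_x (\sum_i (F i)%:E * (\1_[set x | k x = i] x)%:E))%E.
  apply: eq_integral => x _; rewrite (bigD1 (k x))//= big1.
    by rewrite indicE mem_set// mule1 adde0.
  move=> i ik; rewrite indicE memNset ?mule0// => /= /esym/eqP.
  by rewrite (negbTE ik).
rewrite ge0_integral_sum//.
- apply: eq_bigr => i _; rewrite ge0_integralZl//.
  + by rewrite integral_indic// setIT.
  + by apply/measurable_EFinP; exact: measurable_indic.
  + by rewrite lee_fin F0.
- move=> i; apply: measurable_funeM; apply/measurable_EFinP; exact: measurable_indic.
- by move=> i x _; rewrite mule_ge0// lee_fin F0.
Qed.

Lemma countable_basis_seq {Y : topologicalType} : @second_countable Y ->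
  exists C : nat -> set Y, (forall i, open (C i)) /\
    forall y V, nbhs y V -> exists2 i, C i y & C i `<=` V.
Proof.
case=> B /countable_injP[f finj] [oB nB].
exists (fun i => \bigcup_(W in B `&` f @^-1` [set i]) W); split.
  by move=> i; apply: bigcup_open => W [/oB].
move=> y V /nB[W [BW Wy] WV]; exists (f W); first by exists W.
move=> z [W' [BW' /= e] W'z]; apply: WV.
by rewrite -(finj _ _ _ _ e)// inE.
Qed.

Lemma measurable_finite_range {d d'} {T : measurableType d} {T' : measurableType d'}
    (I : finType) (k : T -> I) (F : I -> T') :
  (forall i, measurable [set x | k x = i]) -> measurable_fun setT (F \o k).
Proof.
move=> mk _ A mA; rewrite setTI.
rewrite (_ : _ @^-1` A = \bigcup_(i in [set i | A (F i)]) [set x | k x = i]).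
  by apply: fin_bigcup_measurable => // i _; exact: mk.
by apply/seteqP; split => [x Ax|x [i Ai /= ki]]; [exists (k x)|rewrite /= ki].
Qed.

Lemma lee_real_lt {R : realFieldType} (x y : \bar R) :
  (forall r : R, r%:E < x -> r%:E <= y)%E -> (x <= y)%E.
Proof.
move=> xy; rewrite leNgt; apply/negP.
case: x y xy => [x| |] [y| |]//= xy; rewrite ?lte_fin => yx.
- by have := xy ((x + y) / 2); rewrite lte_fin lee_fin; lra.
- by have := xy (x - 1); rewrite lte_fin ltrBlDr ltrDl ltr01 => /(_ isT).
- by have := xy (y + 1) (ltry _); rewrite lee_fin; lra.
- by have := xy 0 (ltry _).
Qed.

(** * Limits of probability measures on a compact space *)

Lemma pushforward_probability {R : realType} {d1 d2} {T1 : measurableType d1}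
    {T2 : measurableType d2} (P : probability T1 R) {f : T1 -> T2}
    (mf : measurable_fun setT f) :
  exists Q : probability T2 R, (forall A, Q A = P (f @^-1` A)) /\
    forall h : T2 -> \bar R, measurable_fun setT h -> (forall x, (0 <= h x)%E) ->
      (\int[Q]_x h x = \int[P]_x h (f x))%E.
Proof.
pose f' : {mfun T1 >-> T2} := HB.pack f (isMeasurableFun.Build _ _ _ _ f mf).
exists (distribution P f' : probability T2 R); split => // h mh h0.
by rewrite ge0_integral_pushforward// preimage_setT.
Qed.

Section borel_topology.
Context {R : realType} {Y : pseudoPMetricType R}.

Lemma open_borel (A : set Y) : open A -> measurable (A : set (@borel R Y)).
Proof. by move=> oA; exact: sub_sigma_algebra. Qed.

Lemma measurable_fun_borel {d} {T : measurableType d} (f : T -> @borel R Y) :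
  (forall G : set Y, open G -> measurable (f @^-1` G)) -> measurable_fun setT f.
Proof.
move=> mf; apply: (@measurability _ _ T (@borel R Y) setT f (@open Y)) => // _ [G oG <-].
by rewrite setTI; exact: mf.
Qed.

Lemma lsc_borel (h : Y -> \bar R) :
  lower_semicontinuous h -> measurable_fun setT (h : @borel R Y -> \bar R).
Proof.
move=> lh; apply: (measurability _ (ErealGenOInfty.measurableE R)) => _ [_ [x ->] <-].
rewrite setTI preimage_itvoy; apply: open_borel.
by move/lower_semicontinuousP : lh; exact.
Qed.

End borel_topology.

(** * Cells of a sequence of sets and infima over them *)

Section point_code.
Context {T : Type} (C : nat -> set T).

(** Bits are stored most recent first, as in [bits_code], so consing a bit refines a cell. *)
Fixpoint point_code (m : nat) (y : T) : seq bool :=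
  if m is m'.+1 then `[< C m' y >] :: point_code m' y else [::].

Definition cell (s : seq bool) : set T := [set y | point_code (size s) y = s].

Lemma size_point_code m y : size (point_code m y) = m.
Proof. by elim: m => //= m ->. Qed.

Lemma cell_cons b s :
  cell (b :: s) = cell s `&` (if b then C (size s) else ~` C (size s)).
Proof.
apply/seteqP; split => y; rewrite /cell/=.
  move=> [<- ->]; split=> //; case: asboolP => //.
by case=> ->; case: b => /= h; congr (_ :: _); [apply/asboolP|apply/asboolPn].
Qed.

End point_code.

Lemma measurable_cell {d} {T : measurableType d} (C : nat -> set T) s :
  (forall i, measurable (C i)) -> measurable (cell C s).
Proof.
move=> mC; elim: s => [|b s IH].
  by rewrite (_ : cell _ _ = setT)//; apply/seteqP; split.
by rewrite cell_cons; apply: measurableI => //; case: b => //; exact: measurableC.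
Qed.

Section cell_inf.
Context {R : realType} {T : Type} (C : nat -> set T) (h : T -> \bar R).
Hypothesis h_ge0 : forall y, (0 <= h y)%E.

(* Truncated at [size s] to stay finite. *)
Definition cell_inf (s : seq bool) : R :=
  fine (Order.min (size s)%:R%:E (ereal_inf (h @` cell C s))).

Lemma cell_infE s :
  (cell_inf s)%:E = Order.min (size s)%:R%:E (ereal_inf (h @` cell C s)).
Proof.
rewrite /cell_inf fineK// ge0_fin_numE.
  by apply: le_lt_trans (ltry ((size s)%:R)); rewrite ge_min lexx.
rewrite le_min lee_fin ler0n/=.
by apply: le_ereal_inf_tmp => _ [y _ <-].
Qed.

Lemma cell_inf_ge0 s : 0 <= cell_inf s.
Proof.
rewrite -lee_fin cell_infE le_min lee_fin ler0n/=.
by apply: le_ereal_inf_tmp => _ [y _ <-].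
Qed.

Lemma cell_inf_le s y : cell C s y -> ((cell_inf s)%:E <= h y)%E.
Proof.
move=> sy; rewrite cell_infE ge_min; apply/orP; right.
by apply: ereal_inf_lbound; exists y.
Qed.

Lemma le_cell_inf s s' : (size s <= size s')%N -> cell C s' `<=` cell C s ->
  cell_inf s <= cell_inf s'.
Proof.
move=> ss' cs's; rewrite -lee_fin !cell_infE le_min !ge_min lee_fin ler_nat ss'/=.
apply/orP; right; apply: le_ereal_inf_tmp => _ [y /cs's sy <-].
by apply: ereal_inf_lbound; exists y.
Qed.

Lemma cell_inf_ge s (x : R) : x <= (size s)%:R ->
  (forall y, cell C s y -> (x%:E <= h y)%E) -> x <= cell_inf s.
Proof.
move=> xs xh; rewrite -lee_fin cell_infE le_min lee_fin xs/=.
by apply: le_ereal_inf_tmp => _ [y sy <-]; exact: xh.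
Qed.

End cell_inf.

Section prob_seq_compact.
Context {R : realType} {Y : pseudoPMetricType R}.
Hypothesis cY : compact [set: Y].

(** A one-sided substitute for weak sequential compactness. Its version for couplings is applied to
    the cost, to [M - L] and to continuous test functions, where upper bounds are enough. *)
Lemma prob_seq_compact (mu : nat -> @prob R Y) : exists mu0 : @prob R Y,
  forall h : Y -> \bar R, (forall y, 0 <= h y)%E -> lower_semicontinuous h ->
  forall B : R, (\forall n \near \oo, \int[mu n]_y h y <= B%:E)%E ->
  (\int[mu0]_y h y <= B%:E)%E.
Proof.
(* Along one ultrafilter finer than [\oo] all cell masses converge at once, and every eventual bound
   still holds. *)
have [U [FU sU]] := ultraFilterLemma (F := \oo) _.
have [C [oC bC]] := countable_basis_seq (compact_second_countable cY).
have mC i : measurable (C i : set (@borel R Y)) by exact: open_borel.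
have mcell s : measurable (cell C s : set (@borel R Y)) by exact: measurable_cell.
pose m n s : R := fine (mu n (cell C s)).
have mE n s : mu n (cell C s) = (m n s)%:E.
  by rewrite fineK// fin_num_measure.
have m01 n s : 0 <= m n s <= 1.
  by rewrite -!lee_fin -mE measure_ge0 probability_le1.
have /choice[a ha] : forall s, exists l : R, m ^~ s @ U --> l.
  by move=> s; exact: (ultra_cvg_itv U _ (m ^~ s) 0 1).
have a_ge0 s : 0 <= a s.
  by apply: (cvgr_to_ge (ha s)); apply: nearW => n; case/andP: (m01 n s).
have cell_nil : cell C [::] = setT by apply/seteqP; split.
have a_nil : a [::] = 1.
  apply: (cvg_unique _ (ha _)) => //.
  rewrite (_ : m ^~ [::] = fun=> 1); first exact: cvg_cst.
  by apply/funext => n; rewrite /m cell_nil probability_setT.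
have a_split s : a s = a (false :: s) + a (true :: s).
  apply: (cvg_unique _ (ha _)) => //.
  rewrite (_ : m ^~ s = fun n => m n (false :: s) + m n (true :: s)).
    by apply: cvgD; exact: ha.
  apply/funext => n; apply: EFin_inj; rewrite EFinD -!mE !cell_cons -setDE.
  exact: measureDI.
(* An empty cell has mass 0 under every [mu n], so its limit mass vanishes. *)
have cell0 s : 0 < a s -> exists y, cell C s y.
  move=> as0; apply/set0P/eqP => cs0; move: as0.
  rewrite (_ : a s = 0) ?ltxx//; apply: (cvg_unique _ (ha _)) => //.
  rewrite (_ : m ^~ s = fun=> 0); first exact: cvg_cst.
  by apply/funext => n; rewrite /m cs0 measure0.
have [P [code [code0 codeS code_gt0 Pcode]]] := bits_realization a a_ge0 a_nil a_split.
have size_code n w : size (code n w) = n.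
  by elim: n => [|n IH]; rewrite ?code0//; have [b ->] := codeS n w; rewrite /= IH.
have cell_anti n k w : (n <= k)%N -> cell C (code k w) `<=` cell C (code n w).
  move=> /subnK <-; elim: (k - n)%N => // j IH; rewrite addSn.
  by have [b ->] := codeS (j + n)%N w; rewrite cell_cons => y [/IH].
have [t tP] : exists t : nat -> R -> Y, forall n w, cell C (code n w) (t n w).
  have /choice[t ht] : forall nw : nat * R, exists y, cell C (code nw.1 nw.2) y.
    by move=> nw; exact: cell0.
  by exists (fun n w => t (n, w)) => n w; exact: (ht (n, w)).
have /choice[f fP] : forall w, exists y, cluster (t ^~ w @ \oo) y.
  move=> w; have [|y [_ ?]] := cY (t ^~ w @ \oo) _; last by exists y.
  exact: (@filterE _ \oo).
(* After level [i], all [t n w] lie on the side of [C i] chosen by bit [i]. For their cluster point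
   [f w], membership in the open set [C i] thus forces the bit [true], whereas a [true] bit only
   yields the closure of [C i]. *)
have cell_C i w b : code i.+1 w = b :: code i w ->
    forall n, (i < n)%N -> (if b then C i else ~` C i) (t n w).
  move=> e n lin; have := cell_anti _ _ w lin _ (tP n w).
  by rewrite e cell_cons size_code => -[].
have C_code i w : C i (f w) -> code i.+1 w = true :: code i w.
  move=> Cfw; have [[] //eb] := codeS i w.
  have [_ [[n lin <-] Cy]] : [set t n w | n in [set n | (i < n)%N]] `&` C i !=set0.
    apply: (fP w); last exact: open_nbhs_nbhs.
    by exists i.+1 => // n lin; exists n.
  by have := cell_C _ _ _ eb n lin.
have code_C i w : code i.+1 w = true :: code i w -> closure (C i) (f w).
  move=> e V Vfw; apply: (fP w) => //.
  by exists i.+1 => // n; exact: (cell_C _ _ _ e).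
have mcode n s : measurable [set w : measurableTypeR R | code n w = s].
  have [<-|ns] := eqVneq (size s) n; first exact: (Pcode s).1.
  rewrite (_ : [set _ | _] = set0)//; apply/seteqP; split => // w /= e.
  by move: ns; rewrite -e size_code eqxx.
(* By regularity, [f @^-1` G] is the union of the events [bit i] over the base
   sets [C i] with closure in [G]. *)
have mf : measurable_fun setT (f : measurableTypeR R -> @borel R Y).
  apply: measurable_fun_borel => G oG.
  rewrite (_ : f @^-1` G = \bigcup_(i in [set i | closure (C i) `<=` G])
     [set w | code i.+1 w = true :: code i w]).
    apply: bigcup_measurable => i _.
    rewrite (_ : [set _ | _] =
        \bigcup_s ([set w | code i w = s] `&` [set w | code i.+1 w = true :: s])).
      apply: countable_bigcupT_measurable => [|s]; first exact: countableP.
      by apply: measurableI; exact: mcode.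
    by apply/seteqP; split => [w e|w [s _ [/= <-]]]; first exists (code i w).
  apply/seteqP; split => [w Gfw|w [i /= iG /code_C]]; last exact: iG.
  have [V Vfw VG] := uniform_regular (open_nbhs_nbhs (conj oG Gfw)).
  have [i Ci CiV] := bC _ _ Vfw.
  exists i; last exact: C_code.
  exact: subset_trans (closure_subset CiV) VG.
have [mu0 [_ mu0E]] := pushforward_probability P mf.
exists mu0 => h h0 lh B hB; have mh := lsc_borel _ lh; rewrite mu0E//.
pose g n w := (cell_inf C h (code n w))%:E.
(* Codes of fixed length form a finite type, so level-[n] integrals are finite sums. *)
pose codet n (w : measurableTypeR R) : n.-tuple bool :=
  Tuple (introT eqP (size_code n w)).
pose ycode n (y : @borel R Y) : n.-tuple bool :=
  Tuple (introT eqP (size_point_code C n y)).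
have inf_ge0 n (s : n.-tuple bool) : 0 <= cell_inf C h s by exact: cell_inf_ge0.
have ycodeE n (s : n.-tuple bool) : [set y | ycode n y = s] = cell C s.
  apply/seteqP; split => y; rewrite /cell /= size_tuple.
    by move=> <-.
  by move=> e; exact: val_inj.
(* With [m k s] for [a s], the sum is the integral under [mu k] of a step function below [h], hence
   eventually at most [B]; a finite sum passes to the limit along [U]. *)
have sumB n : \sum_(s : n.-tuple bool) cell_inf C h s * a s <= B.
  have : (fun k => \sum_(s : n.-tuple bool) cell_inf C h s * m k s) @ U -->
      \sum_(s : n.-tuple bool) cell_inf C h s * a s.
    by apply: cvg_big => [|s _]; [exact: add_continuous|apply: cvgMl_tmp; exact: ha].
  move/cvgr_to_le; apply; apply: filterS (sU _ hB) => k; rewrite -lee_fin.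
  apply: le_trans.
  rewrite -sumEFin; under eq_bigr do rewrite EFinM -mE -ycodeE.
  rewrite -(integral_finite_range (mu k) _ (ycode n) (fun s => cell_inf C h s))//.
    apply: ge0_le_integral => //.
    - by move=> y _; rewrite lee_fin.
    - apply/measurable_EFinP.
      apply: (measurable_finite_range _ (ycode n) (fun s => cell_inf C h s)) => s.
      by rewrite ycodeE.
    - by move=> y _; apply: cell_inf_le => //; rewrite -ycodeE.
  by move=> s; rewrite ycodeE.
have mcodet n (s : n.-tuple bool) :
    [set w | codet n w = s] = [set w | code (size s) w = s].
  apply/seteqP; split => w; rewrite /= size_tuple; first by move=> <-.
  by move=> e; exact: val_inj.
have mg n : measurable_fun setT (g n : measurableTypeR R -> \bar R).
  apply/measurable_EFinP.
  apply: (measurable_finite_range _ (codet n) (fun s => cell_inf C h s)) => s.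
  by rewrite mcodet.
have intB n : (\int[P]_w g n w <= B%:E)%E.
  rewrite /g (integral_finite_range P _ (codet n) (fun s => cell_inf C h s))//.
    rewrite (eq_bigr (fun s : n.-tuple bool => (cell_inf C h s * a s)%:E)) => [|s _].
      by rewrite sumEFin lee_fin; exact: sumB.
    by rewrite mcodet EFinM; congr (_ * _)%E; exact: (Pcode s).2.
  by move=> s; rewrite mcodet.
have g_ge0 n w : (0 <= g n w)%E by rewrite lee_fin cell_inf_ge0.
have ndg w : nondecreasing_seq (g ^~ w).
  move=> n k nk; rewrite lee_fin le_cell_inf ?size_code//.
  exact: cell_anti.
have cg w : g ^~ w @ \oo --> limn (g ^~ w).
  exact: ereal_nondecreasing_is_cvgn.
(* If [x < h (f w)], some [C i] containing [f w] has [h > x] on it. Bit [i] is then [true], so all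
   later cells of [w] lie in [C i], and their truncated infima reach [x] once the level exceeds
   [x]. *)
have hlim w : (h (f w) <= limn (g ^~ w))%E.
  apply: lee_real_lt => x xh.
  have [V Vfw hV] := lh _ _ xh.
  have [i Ci CiV] := bC _ _ Vfw.
  have e := C_code _ _ Ci.
  have xg : \forall n \near \oo, (x%:E <= g n w)%E.
    near=> n; rewrite lee_fin; apply: cell_inf_ge => //.
      rewrite size_code; near: n; exact: nbhs_infty_ger.
    have lin : (i < n)%N by near: n; exact: nbhs_infty_gt.
    move=> y /(cell_anti _ _ _ lin); rewrite e cell_cons size_code => -[_ /CiV].
    by move=> /hV/ltW.
  exact: cvge_to_ge (cg w) xg.
have mc : (\int[P]_w limn (g ^~ w) = limn (fun n => \int[P]_w g n w))%E.
  by apply: monotone_convergence => // w _; exact: ndg.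
apply: le_trans (_ : _ <= \int[P]_w limn (g ^~ w))%E _.
  apply: ge0_le_integral => //.
  - exact: measurableT_comp mh mf.
  - by apply: (emeasurable_fun_cvg g) => // w _; exact: cg.
rewrite mc; apply: lime_le; last exact: nearW.
apply: ereal_nondecreasing_is_cvgn => n k nk.
by apply: ge0_le_integral => // w _; exact: ndg.
Unshelve. all: end_near.
Qed.
End prob_seq_compact.

(** * Couplings and their marginals *)

Lemma lsc_comp {R : realType} {Y Z : topologicalType} (g : Y -> Z) (h : Z -> \bar R) :
  continuous g -> lower_semicontinuous h -> lower_semicontinuous (h \o g).
Proof.
move=> cg lh y r /lh[V Vgy hV]; exists (g @^-1` V); first exact: cg.
by move=> z /hV.
Qed.

Lemma lsc_EFin {R : realType} : lower_semicontinuous (@EFin R).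
Proof.
move=> x r; rewrite lte_fin => rx; exists [set y | r < y] => //.
exact: lt_nbhsr.
Qed.

(** * Continuous test functions determine a Borel probability *)

Section borel_probability.
Context {R : realType} {X : pseudoPMetricType R}.

Lemma continuous_borel (f : X -> R) :
  continuous f -> measurable_fun setT (EFin \o f : @borel R X -> \bar R).
Proof. by move=> cf; apply: lsc_borel; exact: lsc_comp cf lsc_EFin. Qed.

Hypothesis cX : compact [set: X].

(** By regularity [G] is an increasing union of closed sets [K n]. A Urysohn function between [K n]
    and the complement of [G] gives [P (K n) <= Q G]; then [n] tends to infinity. *)
Lemma prob_le_open (P Q : @prob R X) :
  (forall f : X -> R, continuous f -> (forall x, 0 <= f x <= 1) ->
    (\int[P]_x (f x)%:E <= \int[Q]_x (f x)%:E)%E) ->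
  forall G, open G -> (P G <= Q G)%E.
Proof.
move=> PQ G oG; have [C [oC bC]] := countable_basis_seq (compact_second_countable cX).
pose F i : set X := if `[< closure (C i) `<=` G >] then closure (C i) else set0.
have cF i : closed (F i).
  by rewrite /F; case: asboolP => _; [exact: closed_closure|exact: closed0].
have FG i : F i `<=` G by rewrite /F; case: asboolP => // _; exact: sub0set.
pose K n := \big[setU/set0]_(i < n.+1) F i.
have cK n : closed (K n) by apply: closed_bigsetU => i _; exact: cF.
have KG n : K n `<=` G.
  by apply: subset_trans (@bigsetU_bigcup _ F n.+1) _; exact: bigcup_sub.
have GK : G = \bigcup_n K n.
  rewrite bigcup_bigsetU_bigcup; apply/seteqP; split => [x Gx|x [i _] /FG//].
  have [V Vx VG] := uniform_regular (open_nbhs_nbhs (conj oG Gx)).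
  have [i Ci CiV] := bC _ _ Vx.
  exists i => //; rewrite /F asboolT; first exact: subset_closure.
  exact: subset_trans (closure_subset CiV) VG.
have mG := open_borel _ oG.
have mK n : measurable (K n : set (@borel R X)).
  by rewrite -[K n]setCK; apply: measurableC; apply: open_borel; apply: closed_openC.
have PK n : (P (K n) <= Q G)%E.
  have [f [cf f0 f1 f01]] : exists f : X -> R, [/\ continuous f,
      f @` (~` G) `<=` [set 0], f @` (K n) `<=` [set 1] & range f `<=` `[0, 1]].
    apply: urysohn_ext_itv => //; first exact: pseudometric_normal.
      exact: open_closedC.
    by apply/seteqP; split => // x [nG /KG].
  have {}f01 x : 0 <= f x <= 1.
    by have := f01 (f x) (ex_intro2 _ _ x I erefl); rewrite /= in_itv.
  have mf := continuous_borel _ cf.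
  apply: le_trans (_ : _ <= \int[P]_x (f x)%:E)%E _.
    rewrite -(setIT (K n)) -integral_indic//.
    apply: ge0_le_integral => //.
    - by apply/measurable_EFinP; exact: measurable_indic.
    - move=> x _; rewrite lee_fin indicE; have [/set_mem Kx|_] := boolP (x \in K n).
        by rewrite (f1 (f x)) //; exists x.
      by case/andP: (f01 x).
  apply: le_trans (PQ _ cf f01) _.
  rewrite -(setIT G) -integral_indic//.
  apply: ge0_le_integral => //.
  - by move=> x _; rewrite lee_fin; case/andP: (f01 x).
  - by apply/measurable_EFinP; exact: measurable_indic.
  - move=> x _; rewrite lee_fin indicE; have [_|/negP nG] := boolP (x \in G).
      by case/andP: (f01 x).
    by rewrite (f0 (f x)) //; exists x => // /mem_set.
have cvgK : (P \o K) n @[n --> \oo] --> P G.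
  rewrite [in P G]GK; apply: nondecreasing_cvg_mu => //.
    by rewrite -GK.
  by move=> n k nk; rewrite subsetEset; apply: subset_bigsetU.
by apply: (cvge_to_le cvgK); exact: nearW.
Qed.

(** Applying the inequality to [1 - f] reverses it, so [P] and [Q] agree on open sets, a generating
    family stable under intersection. *)
Lemma prob_eq_continuous (P Q : @prob R X) :
  (forall f : X -> R, continuous f -> (forall x, 0 <= f x <= 1) ->
    (\int[P]_x (f x)%:E <= \int[Q]_x (f x)%:E)%E) ->
  forall A, measurable A -> P A = Q A.
Proof.
move=> PQ.
have split_int (S : @prob R X) (f : X -> R) :
    continuous f -> (forall x, 0 <= f x <= 1) ->
    (\int[S]_x (1 - f x)%:E + \int[S]_x (f x)%:E = 1)%E.
  move=> cf f01; have mf := continuous_borel _ cf.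
  have mf' : measurable_fun setT (fun x : @borel R X => (1 - f x)%:E).
    by apply/measurable_EFinP/measurable_funB => //; exact/measurable_EFinP.
  rewrite -ge0_integralD//.
  - under eq_integral do rewrite -EFinD subrK.
    by rewrite integral_cst// mul1e; exact: probability_setT.
  - by move=> x _; rewrite lee_fin subr_ge0; case/andP: (f01 x).
  - by move=> x _; rewrite lee_fin; case/andP: (f01 x).
have QP (f : X -> R) : continuous f -> (forall x, 0 <= f x <= 1) ->
    (\int[Q]_x (f x)%:E <= \int[P]_x (f x)%:E)%E.
  move=> cf f01.
  have f01' x : 0 <= 1 - f x <= 1 by have := f01 x; lra.
  have cf' : continuous (fun x => 1 - f x).
    by move=> x; apply: cvgB; [exact: cvg_cst|exact: cf].
  have int_ge0 (S : @prob R X) (g : X -> R) :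
      (forall x, 0 <= g x <= 1) -> (0 <= \int[S]_x (g x)%:E)%E.
    by move=> g01; apply: integral_ge0 => x _; rewrite lee_fin; case/andP: (g01 x).
  have fin (S : @prob R X) : exists2 p : R,
      (\int[S]_x (1 - f x)%:E = (1 - p)%:E)%E & (\int[S]_x (f x)%:E = p%:E)%E.
    move: (split_int S _ cf f01) (int_ge0 S _ f01) (int_ge0 S _ f01').
    case: (\int[S]_x (1 - f x)%:E)%E => [p'| |]; case: (\int[S]_x (f x)%:E)%E => [p| |]//.
    by move=> [<-] _ _; exists p => //; rewrite addrK.
  have [p p1 ->] := fin P; have [q q1 ->] := fin Q.
  by have := PQ _ cf' f01'; rewrite p1 q1 !lee_fin; lra.
move=> A mA.
have := (@measure_unique _ R (@borel R X) (@open X) (fun=> setT) _ _ _ _ P Q _ _ A mA).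
apply => //.
- by move=> B B' oB oB'; exact: openI.
- by move=> _; exact: openT.
- by rewrite bigcup_const.
- by move=> G oG; apply/eqP; rewrite eq_le !prob_le_open.
- by move=> _; rewrite /= (le_lt_trans (probability_le1 _ _)) ?ltry.
Qed.

End borel_probability.

Lemma continuous_fst {X Y : topologicalType} : continuous (@fst X Y).
Proof. by move=> z; exact: cvg_fst. Qed.

Lemma continuous_snd {X Y : topologicalType} : continuous (@snd X Y).
Proof. by move=> z; exact: cvg_snd. Qed.

Section couplings.
Context {R : realType} {X : pseudoPMetricType R}.
Hypothesis cX : compact [set: X].

Let BB := (@borel R X * @borel R X)%type.
(* The pointed pseudometric structure is not inferred on products. *)
Let XX : pseudoPMetricType R := HB.pack (X * X)%type
  (PseudoMetric.on (X * X)%type) (isPointed.Build (X * X)%type (point, point)).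

(** By second countability an open set of the product is a countable union of open rectangles. *)
Lemma open_borel_prod (G : set (X * X)) : open G -> measurable (G : set BB).
Proof.
move=> oG; have [C [oC bC]] := countable_basis_seq (compact_second_countable cX).
rewrite (_ : G = \bigcup_(ij in [set ij | C ij.1 `*` C ij.2 `<=` G]) (C ij.1 `*` C ij.2)).
  rewrite bigcup_mkcond; apply: countable_bigcupT_measurable => [|ij].
    exact: countableP.
  case: ifP => // _; apply: measurableX; exact: open_borel.
apply/seteqP; split => [[x y] Gxy|z [ij CG /CG]//].
have [[V W]/= [Vx Wy] VWG] := open_nbhs_nbhs (conj oG Gxy).
have [i Cix CiV] := bC _ _ Vx; have [j Cjy CjW] := bC _ _ Wy.
by exists (i, j) => // z [/= /CiV Vz /CjW Wz]; exact: VWG.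
Qed.

Lemma lsc_borel_prod (h : X * X -> \bar R) :
  lower_semicontinuous h -> measurable_fun setT (h : BB -> \bar R).
Proof.
move=> lh; apply: (measurability _ (ErealGenOInfty.measurableE R)) => _ [_ [x ->] <-].
rewrite setTI preimage_itvoy; apply: open_borel_prod.
by move/lower_semicontinuousP : lh; exact.
Qed.

Lemma coupling_seq_compact (pi : nat -> probability BB R) :
  exists pi0 : probability BB R,
  forall h : X * X -> \bar R, (forall z, 0 <= h z)%E -> lower_semicontinuous h ->
  forall B : R, (\forall n \near \oo, \int[pi n]_z h z <= B%:E)%E ->
  (\int[pi0]_z h z <= B%:E)%E.
Proof.
have cXX : compact [set: XX].
  rewrite (_ : [set: XX] = [set: X] `*` [set: X]); first exact: compact_setX.
  by apply/seteqP; split.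
(* The product sigma-algebra and the Borel sigma-algebra of the product coincide, so measures move
   between them along the identity. *)
have m1 : measurable_fun setT (id : BB -> @borel R XX).
  by apply: measurable_fun_borel => G; exact: open_borel_prod.
have m2 : measurable_fun setT (id : @borel R XX -> BB).
  apply/measurable_fun_pairP; split.
    apply: measurable_fun_borel => G oG; apply: (@open_borel R XX).
    by apply: (open_comp _ oG) => z _; exact: continuous_fst.
  apply: measurable_fun_borel => G oG; apply: (@open_borel R XX).
  by apply: (open_comp _ oG) => z _; exact: continuous_snd.
have /choice[mu muE] : forall n, exists mu : @prob R XX, forall h : XX -> \bar R,
    lower_semicontinuous h -> (forall z, 0 <= h z)%E ->
    (\int[mu]_z h z = \int[pi n]_z h z)%E.
  move=> n; have [mu [_ muE]] := pushforward_probability (pi n) m1.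
  by exists mu => h lh h0; rewrite muE//; exact: lsc_borel.
have [mu0 mu0P] := prob_seq_compact cXX mu.
have [pi0 [_ pi0E]] := pushforward_probability mu0 m2.
exists pi0 => h h0 lh B hB; rewrite pi0E//; last exact: lsc_borel_prod.
by apply: mu0P => //; apply: filterS hB => n; rewrite muE.
Qed.

End couplings.

Local Open Scope ereal_scope.

(** * Passing to the limit *)

(** The integral of [f] may be [-oo]. Writing [M - f] as [(M - f^+) + f^-] leaves nonnegative
    integrands only, and [f^+ <= M] has a finite integral. *)
Lemma integral_cstB {R : realType} {d} {T : measurableType d} (P : probability T R)
    (f : T -> \bar R) (M : R) : measurable_fun setT f ->
  (0 <= M)%R -> (forall x, f x <= M%:E) ->
  \int[P]_x (M%:E - f x) = M%:E - \int[P]_x f x.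
Proof.
move=> mf M0 fM.
have mp := measurable_funepos mf; have mn := measurable_funeneg mf.
have pM x : f^\+ x <= M%:E by rewrite funeposE ge_max fM lee_fin.
have mMp : measurable_fun setT (fun x => M%:E - f^\+ x).
  by apply: emeasurable_funB => //; exact: measurable_cst.
have pfin x : f^\+ x \is a fin_num.
  by rewrite ge0_fin_numE// (le_lt_trans (pM x)) ?ltry.
have Mp0 x : 0 <= M%:E - f^\+ x by rewrite leeBrDr// add0e pM.
have e1 : \int[P]_x (M%:E - f x) = \int[P]_x (M%:E - f^\+ x) + \int[P]_x f^\- x.
  rewrite -ge0_integralD//; apply: eq_integral => x _.
  rewrite funeposE funenegE; case: (f x) (fM x) => [r| |]//=.
    move=> _; rewrite -!EFin_max -!EFinB -EFinD; congr EFin.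
    by rewrite /Order.max; case: ifPn; case: ifPn; lra.
  by move=> _; rewrite maxNye// maxye oppe0 adde0.
have e2 : \int[P]_x (M%:E - f^\+ x) + \int[P]_x f^\+ x = M%:E.
  rewrite -ge0_integralD//.
  transitivity (\int[P]_x (cst M%:E x)).
    apply: eq_integral => x _; by rewrite subeK.
  by rewrite integral_cst// [X in _ * X]probability_setT mule1.
rewrite e1 (integralE _ _ f); move: e2.
have : 0 <= \int[P]_x (M%:E - f^\+ x) by exact: integral_ge0.
have : 0 <= \int[P]_x f^\+ x by exact: integral_ge0.
have : 0 <= \int[P]_x f^\- x by exact: integral_ge0.
case: (\int[P]_x f^\- x) => [n| |]//; case: (\int[P]_x f^\+ x) => [p| |]//;
  case: (\int[P]_x (M%:E - f^\+ x)) => [a| |]// _ _ _ [<-] //.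
by rewrite -!EFinD; congr EFin; lra.
Qed.

Section upper_semicontinuous.
Context {R : realType} {X : pseudoPMetricType R} (L : X -> \bar R).
Hypothesis uscL : upper_semicontinuous L.

(** Each point has a neighbourhood on which [L] is below a real; compactness makes the bound
    uniform. *)
Lemma usc_bounded : compact [set: X] -> (forall x, L x < +oo) ->
  exists2 M : R, (0 <= M)%R & forall x, L x <= M%:E.
Proof.
move=> cX LltT.
have [|N _ LN] := iffLR (compact_near_coveringP _) cX nat \oo
    (fun n x => L x <= n%:R%:E) _ _.
  move=> x _; have [a La] : exists a : R, L x < a%:E.
    case: (L x) (LltT x) => [r| |]// _; last by exists 0%R; rewrite ltNyr.
    by exists (r + 1)%R; rewrite lte_fin ltrDl.
  have [V Vx LV] := uscL _ _ La.
  exists (V, [set n : nat | (a <= n%:R)%R]) => [|[y n] /= [Vy an]].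
    by split => //=; exact: nbhs_infty_ger.
  by apply: le_trans (ltW (LV _ Vy)) _; rewrite lee_fin.
by exists N%:R => // x; exact: (LN N (leqnn N) x I).
Qed.

Lemma usc_borel : measurable_fun setT (L : @borel R X -> \bar R).
Proof.
apply: (measurability _ (ErealGenInftyO.measurableE R)) => _ [_ [r ->] <-].
rewrite setTI preimage_itvNyo; apply: open_borel; rewrite openE => x /uscL[V Vx LV].
by apply: filterS Vx => y; exact: LV.
Qed.

Lemma lsc_cstB_usc (M : R) : lower_semicontinuous (fun x => M%:E - L x).
Proof.
have LE x (r : R) : (r%:E < M%:E - L x) = (L x < (M - r)%:E).
  case: (L x) => [l| |]/=.
  - by rewrite -EFinB !lte_fin ltrBrDl ltrBrDr.
  - by rewrite /= addeNy ltNge leNye ltNge leey.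
  - by rewrite ltry ltNyr.
move=> x r; rewrite LE => /uscL[V Vx LV]; exists V => // y /LV.
by rewrite LE.
Qed.

End upper_semicontinuous.

(** Both limits of the theorem are obtained this way: the robust value stays above its limit, so
    only bounds by reals [B] beyond the limit remain. *)
Lemma cvge_from_above {R : realType} {I : Type} (F : set_system I) {FF : Filter F}
    (f : I -> \bar R) (S : \bar R) :
  (\forall i \near F, S <= f i) ->
  (forall B : R, S < B%:E -> \forall i \near F, f i <= B%:E) ->
  f @ F --> S.
Proof.
case: S => [s| |] Sf fS.
- have fs (e : R) : (0 < e)%R -> \forall i \near F, f i <= (s + e)%:E.
    by move=> e0; apply: fS; rewrite lte_fin ltrDl.
  apply/fine_cvgP; split.
    apply: filterS2 Sf (fs _ ltr01) => i.
    by case: (f i) => [r| |].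
  apply/cvgrPdist_le => e e0; apply: filterS2 Sf (fs _ e0) => i /=.
  case: (f i) => [r| |]//=; rewrite !lee_fin => sr rs.
  by rewrite distrC ger0_norm; lra.
- apply/cvgeyPge => A; apply: filterS Sf => i.
  by rewrite leye_eq => /eqP ->; rewrite leey.
- by apply/cvgeNyPle => A; apply: fS; rewrite ltNyr.
Qed.

Lemma lee_addgt0_natSinv {R : realType} (x : \bar R) (a : R) :
  (forall n : nat, x <= (a + n.+1%:R^-1)%:E) -> x <= a%:E.
Proof.
move=> xa; apply/lee_addgt0Pr => e e0.
have [n _ ne] := near_infty_natSinv_lt (PosNum e0).
apply: le_trans (xa n) _; rewrite -EFinD lee_fin lerD2l.
by apply/ltW/(ne n) => /=.
Qed.

Section limit.
Context {R : realType} {X : pseudoPMetricType R}.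
Hypothesis cX : compact [set: X].
Variables (P : @prob R X) (D : @prob R X -> @prob R X -> \bar R).
Hypotheses (D_ge0 : forall mu nu, 0 <= D mu nu) (D_refl : D P P = 0).
Hypothesis D_cvg : forall mu : nat -> @prob R X,
  D (mu n) P @[n --> \oo] --> 0 -> weak_cvg mu P.
Variable c : X -> X -> \bar R.
Hypotheses (c_ge0 : forall x y, 0 <= c x y)
  (c_lsc : lower_semicontinuous (fun z : X * X => c z.1 z.2)).
Variables (eps : R) (eps_gt0 : (0 < eps)%R).

Let BB := (@borel R X * @borel R X)%type.

Let mc : measurable_fun setT (fun z : BB => c z.1 z.2).
Proof. exact: (lsc_borel_prod cX _ c_lsc). Qed.

Lemma integral_costZ (r : R) (pi : probability BB R) : (0 <= r)%R ->
  \int[pi]_z (r%:E * c z.1 z.2) = r%:E * \int[pi]_z c z.1 z.2.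
Proof. by move=> r0; rewrite ge0_integralZl. Qed.

Lemma ot_sup_le_robust_sup (L : X -> \bar R) (r : R) : (0 < r)%R ->
  ot_sup c P eps L <= robust_sup D c P eps r L.
Proof.
move=> r0; apply: ge_ereal_sup => _ [Q /= PQ <-].
apply: ereal_sup_ubound; exists Q => //=.
apply: ge_ereal_inf; exists (D P P + OTcost (fun x y => r%:E * c x y) P Q).
  by exists P.
(* A coupling is chosen within [e / r] of the bound [eps]; scaling the cost by [r] turns this slack
   into [e]. *)
rewrite D_refl add0e; apply/lee_addgt0Pr => e e0.
have : OTcost c P Q < (eps + e / r)%:E.
  by apply: le_lt_trans PQ _; rewrite lte_fin ltrDl divr_gt0.
case/ereal_inf_lt => _ [pi /= Ppi <-] lpi.
apply: ge_ereal_inf; exists (\int[pi]_z (r%:E * c z.1 z.2)); first by exists pi.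
rewrite integral_costZ; last exact: ltW.
have -> : (r * eps)%:E + e%:E = r%:E * (eps + e / r)%:E.
  by rewrite -EFinD -EFinM mulrDr mulrCA divff ?mulr1// gt_eqF.
by apply: lee_wpmul2l; rewrite ?lee_fin ltW.
Qed.

Lemma integral_fst (Q : @prob R X) (pi : probability BB R) (h : X -> \bar R) :
  (forall A : set (@borel R X), measurable A -> pi (A `*` setT) = Q A) ->
  measurable_fun setT (h : @borel R X -> \bar R) -> (forall x, 0 <= h x) ->
  \int[pi]_z h z.1 = \int[Q]_x h x.
Proof.
move=> piQ mh h0.
have mfst : measurable_fun setT (@fst (@borel R X) (@borel R X)).
  exact: measurable_fst.
have [S [SA <-//]] := pushforward_probability pi mfst.
apply: eq_measure_integral => A mA _.
apply: etrans (SA A) _; apply: etrans _ (piQ A mA); congr (pi _).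
by apply/seteqP; split => [z|z []].
Qed.

Lemma integral_snd (Q : @prob R X) (pi : probability BB R) (h : X -> \bar R) :
  (forall A : set (@borel R X), measurable A -> pi (setT `*` A) = Q A) ->
  measurable_fun setT (h : @borel R X -> \bar R) -> (forall x, 0 <= h x) ->
  \int[pi]_z h z.2 = \int[Q]_x h x.
Proof.
move=> piQ mh h0.
have msnd : measurable_fun setT (@snd (@borel R X) (@borel R X)).
  exact: measurable_snd.
have [S [SA <-//]] := pushforward_probability pi msnd.
apply: eq_measure_integral => A mA _.
apply: etrans (SA A) _; apply: etrans _ (piQ A mA); congr (pi _).
by apply/seteqP; split => [z|z []].
Qed.

Lemma robust_sup_near (L : X -> \bar R) (B : R) :
  upper_semicontinuous L -> (forall x, L x < +oo) -> ot_sup c P eps L < B%:E ->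
  \forall r \near (0:R)^'+, robust_sup D c P eps r L <= B%:E.
Proof.
(* Subtracting from the upper bound [M] turns [L] into a nonnegative lower semicontinuous function,
   and lower bounds on the expectation of [L] into upper bounds that survive the limit. *)
move=> uscL LltT LB; have [M M0 LM] := usc_bounded _ uscL cX LltT.
have mL := usc_borel _ uscL.
have lscL := lsc_cstB_usc _ uscL M; have mML := lsc_borel _ lscL.
have ML0 x : 0 <= M%:E - L x.
  case: (L x) (LM x) => [l| |]//=; rewrite ?leey//.
  by rewrite -EFinB !lee_fin subr_ge0.
apply: contrapT => nnear.
have bad n : exists r : R,
    [/\ (0 < r)%R, (r < n.+1%:R^-1)%R & B%:E < robust_sup D c P eps r L].
  apply: contrapT => ne; apply: nnear; near=> r; rewrite leNgt; apply/negP => Br.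
  by apply: ne; exists r; split.
(* Near-optimal [eta] and coupling have total below [r (eps + 1/(n+1))]. The divergence term
   inherits this bound; dividing the transport term by [r] bounds the unscaled cost. *)
have /choice[ep epP] : forall n, exists ep : @prob R X * probability BB R,
    [/\ D ep.1 P <= ((eps + 1) * n.+1%:R^-1)%:E,
     forall A : set (@borel R X), measurable A -> ep.2 (A `*` setT) = ep.1 A,
     \int[ep.2]_z c z.1 z.2 <= (eps + n.+1%:R^-1)%:E &
     \int[ep.2]_z (M%:E - L z.2) <= (M - B)%:E].
  move=> n; have [r [r0 rn /ereal_sup_gt[_ [Q /= DQ <-] BQ]]] := bad n.
  have n0 : (0 < n.+1%:R^-1 :> R)%R by rewrite invr_gt0.
  have n1 : (n.+1%:R^-1 <= 1 :> R)%R by rewrite invf_le1// ler1n.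
  have : Dc D (fun x y => r%:E * c x y) Q P < (r * (eps + n.+1%:R^-1))%:E.
    by apply: le_lt_trans DQ _; rewrite lte_fin ltr_pM2l// ltrDl.
  case/ereal_inf_lt => _ [eta _ <-] lteta.
  have OT0 : 0 <= OTcost (fun x y => r%:E * c x y) eta Q.
    apply: le_ereal_inf_tmp => _ [pi _ <-]; apply: integral_ge0 => z _.
    by rewrite mule_ge0// lee_fin ltW.
  have := le_lt_trans (leeDr _ (D_ge0 eta P)) lteta.
  case/ereal_inf_lt => _ [pi [pi1 pi2] <-].
  rewrite integral_costZ ?ltW// EFinM lte_pmul2l//.
  move=> /ltW cpi; exists (eta, pi); split => //=.
    apply: le_trans (ltW (le_lt_trans (leeDl _ OT0) lteta)) _; rewrite lee_fin.
    move: (n.+1%:R^-1)%R n0 n1 rn => d d0 d1 rd.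
    (* The identity is [(eps + 1) d - r (eps + d) = (d - r) eps + (1 - r) d]. *)
    have h1 : (0 <= (d - r) * eps)%R by rewrite mulr_ge0// ?subr_ge0 ltW.
    have h2 : (0 <= (1 - r) * d)%R.
      by rewrite mulr_ge0// ?subr_ge0 ltW// (lt_le_trans rd).
    by lra.
  rewrite (integral_snd Q pi (fun x => M%:E - L x))// integral_cstB//.
  by rewrite EFinB; apply: leeB => //; exact: ltW.
have wc : weak_cvg (fun n => (ep n).1) P.
  apply: D_cvg; apply: (@squeeze_cvge _ _ _ _ (cst 0) _
    (fun n => ((eps + 1) * n.+1%:R^-1)%:E)).
  - by apply: nearW => n; rewrite /= D_ge0; have [] := epP n.
  - exact: cvg_cst.
  - apply: cvg_EFin; first exact: nearW.
    rewrite -[X in _ --> X](mulr0 (eps + 1)%R); apply: cvgMl_tmp; exact: cvg_harmonic.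
have [pi0 pi0P] := coupling_seq_compact cX (fun n => (ep n).2).
have mfst : measurable_fun setT (@fst (@borel R X) (@borel R X)).
  exact: measurable_fst.
have msnd : measurable_fun setT (@snd (@borel R X) (@borel R X)).
  exact: measurable_snd.
have [S1 [S1A S1I]] := pushforward_probability pi0 mfst.
have [S2 [S2A S2I]] := pushforward_probability pi0 msnd.
(* Weak convergence bounds the integrals of [f] under the first marginals by [p + e] eventually; the
   limit inherits the bound, and this one-sided comparison already forces equality. *)
have S1P A : measurable A -> S1 A = P A.
  apply: prob_eq_continuous => // f cf f01; have mf := continuous_borel _ cf.
  have f0 x : 0 <= (f x)%:E by rewrite lee_fin; case/andP: (f01 x).
  rewrite S1I//.
  have [p Pf] : exists p : R, \int[P]_x (f x)%:E = p%:E.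
    have : 0 <= \int[P]_x (f x)%:E by exact: integral_ge0.
    have : \int[P]_x (f x)%:E <= \int[P]_x (cst 1 x).
      by apply: ge0_le_integral => // x _; rewrite lee_fin; case/andP: (f01 x).
    rewrite integral_cst// [X in _ * X]probability_setT mule1.
    by case: (\int[P]_x (f x)%:E) => [p| |]// _ _; exists p.
  rewrite Pf; apply/lee_addgt0Pr => e e0; rewrite -EFinD.
  apply: (pi0P (fun z => (f z.1)%:E)) => //.
    have cf1 : continuous (fun z : X * X => f z.1).
      move=> z; apply: (@continuous_comp _ _ _ fst f); last exact: cf.
      exact: continuous_fst.
    exact: lsc_comp cf1 lsc_EFin.
  have bf : bcont f.
    by split => //; exists 1%R => x; have /andP[f0x f1x] := f01 x; rewrite ger0_norm.
  have pe : nbhs p%:E [set u | u < (p + e)%:E].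
    apply: open_nbhs_nbhs; split; first exact: open_ereal_lt_ereal.
    by rewrite /= lte_fin ltrDl.
  have near_lt : \forall n \near \oo, \int[(ep n).1]_x (f x)%:E < (p + e)%:E.
    by have := wc f bf; rewrite Pf => /(_ _ pe).
  apply: filterS near_lt => n /ltW.
  by have [_ en _ _] := epP n; rewrite (integral_fst (ep n).1 _ (fun x => (f x)%:E)).
have cpi0 : \int[pi0]_z c z.1 z.2 <= eps%:E.
  apply: lee_addgt0_natSinv => n; apply: pi0P => //.
  near=> k; have [_ _ ck _] := epP k; apply: le_trans ck _.
  rewrite lee_fin lerD2l lef_pV2 ?posrE// ler_nat ltnS; near: k; exact: nbhs_infty_ge.
have LS2 : B%:E <= expect S2 L.
  have : \int[S2]_x (M%:E - L x) <= (M - B)%:E.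
    rewrite S2I//; apply: (pi0P (fun z => M%:E - L z.2)) => //.
      exact: lsc_comp continuous_snd lscL.
    by apply: nearW => n; have [] := epP n.
  rewrite integral_cstB// /expect; case: (\int[S2]_x L x) => [l| |]//=.
    by rewrite -EFinB !lee_fin; lra.
  by rewrite leey.
(* [pi0] couples [P] with [S2] at cost at most [eps], so [S2] is admissible and contradicts [LB]. *)
move: LB; apply/negP; rewrite -leNgt; apply: le_trans LS2 _.
apply: ereal_sup_ubound; exists S2 => //=; apply: ge_ereal_inf.
exists (\int[pi0]_z c z.1 z.2) => //; exists pi0 => //; split => A mA.
  by rewrite -S1P// S1A; congr (pi0 _); apply/seteqP; split => [z []|z].
by rewrite S2A; congr (pi0 _); apply/seteqP; split => [z []|z].
Unshelve. all: end_near.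
Qed.

End limit.

Theorem theorem8 (R : realType) (X : pseudoPMetricType R)
  (* X compact Polish: a compact metric space *)
  (hX : hausdorff_space X) (cX : compact [set: X])
  (L : X -> \bar R) (uscL : upper_semicontinuous L) (LltT : forall x, L x < +oo)
  (P : @prob R X)
  (D : @prob R X -> @prob R X -> \bar R)
  (D_ge0 : forall mu nu, 0 <= D mu nu) (D_refl : forall mu, D mu mu = 0)
  (D_lsc : weak_lsc (fun Q => D Q P))
  (D_cvg : forall mu : nat -> @prob R X,
     D (mu n) P @[n --> \oo] --> 0 -> weak_cvg mu P)
  (c : X -> X -> \bar R) (c_ge0 : forall x y, 0 <= c x y)
  (c_lsc : lower_semicontinuous (fun z : X * X => c z.1 z.2))
  (eps : R) (eps_gt0 : (0 < eps)%R) :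
  robust_sup D c P eps r L @[r --> (0:R)^'+] --> ot_sup c P eps L /\
  forall (Theta : Type) (Lt : Theta -> X -> \bar R),
    (forall t, upper_semicontinuous (Lt t)) -> (forall t x, Lt t x < +oo) ->
    ereal_inf [set robust_sup D c P eps r (Lt t) | t in [set: Theta]]
      @[r --> (0:R)^'+]
    --> ereal_inf [set ot_sup c P eps (Lt t) | t in [set: Theta]].
Proof.
have lower L' : \forall r \near (0:R)^'+,
    ot_sup c P eps L' <= robust_sup D c P eps r L'.
  by near=> r; apply: ot_sup_le_robust_sup.
split.
  by apply: cvge_from_above => // B; exact: robust_sup_near.
move=> Theta Lt uscLt LtT; apply: cvge_from_above.
  near=> r; apply: le_ereal_inf_tmp => _ [t _ <-].
  apply: le_trans (_ : _ <= ot_sup c P eps (Lt t)) _.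
    by apply: ereal_inf_lbound; exists t.
  exact: ot_sup_le_robust_sup.
(* A real above the infimum is above the transport value of a single [t], and the estimate for that
   [t] bounds the infimum of the robust values. *)
move=> B /ereal_inf_lt[_ [t _ <-] tB].
have := robust_sup_near cX _ _ D_ge0 D_cvg _ c_ge0 c_lsc _ eps_gt0 _ _
  (uscLt t) (LtT t) tB.
apply: filterS => r.
by apply: le_trans; apply: ereal_inf_lbound; exists t.
Unshelve. all: end_near.
Qed.
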